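(* Let $m\in\mathbb{N}$, $e\in\mathrm{E}_m$, and $a,b,c\in\mathrm{R}_m^e$ with $a\in\mathrm{Orb}_m(b)\cap\mathrm{Orb}_m(c)$. Then there exists $d\in\mathrm{R}_m^e$ such that $a\in\mathrm{Orb}_m(d)$ and $|d|_m=[|b|_m,|c|_m]$.
   Context: $\mathbb{N}=\{1,2,\dots\}$, $\mathbb{Z}_m=\{1,\dots,m\}$, $x\bmod m$ denotes the element of $\mathbb{Z}_m$ congruent to $x$, $[u,v]$ is the least common multiple. $\mathrm{E}_m=\{e\in\mathbb{Z}_m: e^2\equiv e\pmod m\}$. For $a\in\mathbb{Z}$, $|a|_m$ is the smallest $n\in\mathbb{N}$ with $a^n\bmod m\in\mathrm{E}_m$. $a\in\mathbb{Z}_m$ is regular if $a^{|a|_m+1}\equiv a\pmod m$; $\mathrm{R}_m$ is the set of regular residues; for $e\in\mathrm{E}_m$, $\mathrm{R}_m^e=\{a\in\mathrm{R}_m: a^{|a|_m}\equiv e\pmod m\}$. The orbit of $a\in\mathbb{Z}_m$ is $\mathrm{Orb}_m(a)=\{a^n\bmod m: 1\le n\le|a|_m\}$. *)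

(* Defs.v *)
From mathcomp Require Import all_boot all_order all_algebra.
Set Implicit Arguments.
Unset Strict Implicit.
Unset Printing Implicit Defensive.
Import Order.TTheory GRing.Theory Num.Theory.
Local Open Scope ring_scope.

Definition residues (m : nat) : {pred int} := [pred x : int | 1 <= x <= m%:Z].

(* Representatives are taken in {1, ..., m}: the class of 0 is represented by
   m, unlike with modz. *)
Definition resmod (m : nat) (x : int) : int :=
  if (m %| x)%Z then m%:Z else (x %% m)%Z.

Lemma resmodE (m : nat) (x : int) : (resmod m x = x %[mod m])%Z.
Proof.
rewrite /resmod; case: ifP => [/dvdz_mod0P ->|_]; last by rewrite modz_mod.
by rewrite modzz.
Qed.

Lemma resmod_residues (m : nat) (x : int) :
  (0 < m)%N -> resmod m x \in residues m.
Proof.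
move=> m_gt0; have m_neq0 : m%:Z != 0 by case: m m_gt0.
rewrite inE /resmod; case: ifP => [_|ndvd]; first by rewrite lexx andbT lez_nat.
rewrite (ltW (ltz_pmod _ _)) ?ltz_nat // andbT -gtz0_ge1 lt_def modz_ge0 //.
by rewrite andbT; apply/negP=> /eqP/dvdz_mod0P; rewrite ndvd.
Qed.

Definition idempotents (m : nat) : {pred int} :=
  [pred e : int | (e \in residues m) && (e ^+ 2 == e %[mod m])%Z].

Lemma idempotent_power_ex (m : nat) (a : int) : (0 < m)%N ->
  exists n, (0 < n)%N && (resmod m (a ^+ n) \in idempotents m).
Proof.
move=> m_gt0; have m_neq0 : m%:Z != 0 by case: m m_gt0.
have rltm k : (`|(a ^+ k %% m)%Z| < m)%N.
  by rewrite -ltz_nat gez0_abs ?modz_ge0 // ltz_pmod ?ltz_nat.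
have [i [p [p_gt0 eq_ip]]] :
    exists i p, (0 < p)%N /\ (a ^+ (i + p) = a ^+ i %[mod m])%Z.
  pose f (k : 'I_m.+1) := Ordinal (rltm k).
  have /injectivePn[x [y neq_xy]] : ~~ injectiveb f.
    apply/injectiveP=> /leq_card; rewrite !card_ord.
    by rewrite ltnn.
  move/(congr1 (fun z : 'I_m => (nat_of_ord z)%:Z)).
  rewrite /= !gez0_abs ?modz_ge0 // => eq_xy.
  have [lt_xy|lt_yx|/val_inj] := ltngtP x y; last by move/eqP: neq_xy.
    by exists x, (y - x)%N; rewrite subn_gt0 subnKC // ltnW.
  by exists y, (x - y)%N; rewrite subn_gt0 subnKC // ltnW.
have shift k t : (i <= k)%N -> (a ^+ (k + t * p) = a ^+ k %[mod m])%Z.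
  move=> le_ik; elim: t => [|t IHt]; first by rewrite addn0.
  rewrite -IHt mulSnr addnA -(subnKC (leq_trans le_ik (leq_addr (t * p) k))).
  by rewrite addnAC exprD -modzMml eq_ip modzMml -exprD.
exists (i.+1 * p)%N; rewrite muln_gt0 p_gt0 /= inE resmod_residues //=.
apply/eqP; rewrite -modzXm resmodE modzXm -exprM muln2 -addnn shift //.
exact: leq_trans (leqnSn i) (leq_pmulr _ p_gt0).
Qed.

(* The value 0 at the modulus m = 0 is junk. *)
Definition res_order (m : nat) (a : int) : nat :=
  if m is m'.+1 then ex_minn (idempotent_power_ex a (ltn0Sn m')) else 0%N.

Definition regulars (m : nat) : {pred int} :=
  [pred a : int |
    (a \in residues m) && (a ^+ (res_order m a + 1) == a %[mod m])%Z].

Definition regulars_at (m : nat) (e : int) : {pred int} :=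
  [pred a : int | (a \in regulars m) && (a ^+ res_order m a == e %[mod m])%Z].

Definition res_orbit (m : nat) (a : int) : {pred int} :=
  [pred x : int | x \in [seq resmod m (a ^+ n) | n <- iota 1 (res_order m a)]].

(* Main.v *)
(* The residues regular at e form an abelian group with identity e, and
   x |-> x + (1 - e) embeds it into the units of Z/m, turning |x|_m into the
   order and orbits into cyclic subgroups.  In a group, if z is a common power
   of two commuting elements x and y, let pi be the set of primes p with
   v_p(#[y]) <= v_p(#[x]) and w the product of the pi-part of x and the
   pi'-part of y.  The order of w is the lcm, and <w> contains both the pi-part
   and the pi'-part of z. *)
Require Import Defs.
From mathcomp Require Import all_boot all_order all_algebra.
From mathcomp Require Import fingroup cyclic pgroup ring.
Set Implicit Arguments.
Unset Strict Implicit.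
Unset Printing Implicit Defensive.
Import Order.TTheory GRing.Theory Num.Theory GroupScope.
Local Open Scope ring_scope.

(** At a prime the lcm has the larger of the two valuations: that of [m] on [pi], that of [n] off
    [pi]. *)
Lemma lcmn_partn (m n : nat) : (0 < m)%N -> (0 < n)%N ->
  let pi : nat_pred := [pred p | (logn p n <= logn p m)%N] in
  lcmn m n = (m`_pi * n`_pi^')%N.
Proof.
move=> m_gt0 n_gt0 pi.
have l_gt0 : (0 < lcmn m n)%N by rewrite lcmn_gt0 m_gt0.
rewrite -(partnC pi l_gt0); congr (_ * _)%N.
  apply: eq_partn_from_log => // p; rewrite inE => le_nm.
  by rewrite logn_lcm //; apply/maxn_idPl.
apply: eq_partn_from_log => // p; rewrite !inE -ltnNge => lt_mn.
by rewrite logn_lcm //; apply/maxn_idPr/ltnW.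
Qed.

Lemma cycle_lcm_order (gT : finGroupType) (x y z : gT) :
  commute x y -> z \in <[x]>%g -> z \in <[y]>%g ->
  exists i j, z \in <[(x ^+ i * y ^+ j)%g]>%g
              /\ #[(x ^+ i * y ^+ j)%g]%g = lcmn #[x]%g #[y]%g.
Proof.
move=> cxy zx zy.
have := lcmn_partn (order_gt0 x) (order_gt0 y).
set pi : nat_pred := [pred p | _] => /= lcmE.
have [i xpiE] := cycleP _ _ (cycle_constt pi x).
have [j ypiE] := cycleP _ _ (cycle_constt pi^' y).
exists i, j; rewrite -xpiE -ypiE.
have cxy_pi : commute x.`_pi y.`_pi^' by rewrite xpiE ypiE; apply: commuteX2.
have co : coprime #[x.`_pi]%g #[y.`_pi^']%g.
  exact: pnat_coprime (p_elt_constt _ _) (p_elt_constt _ _).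
split; last by rewrite orderM // !order_constt lcmE.
(* Taking constituents commutes with powers: [z] is a power of [x], so its [pi]-part is a power of
   that of [x]; likewise for [y] and [pi^']. *)
rewrite cycleM // -(consttC pi z); apply: mem_mulg.
  by have [k ->] := cycleP _ _ zx; rewrite consttX mem_cycle.
by have [k ->] := cycleP _ _ zy; rewrite consttX mem_cycle.
Qed.

(** For idempotent [e], the equation [x * e = x] places [x] in the ideal [R e], a ring with identity
    [e]. A relation avoids carrying a proof that [x + (1 - e)] is invertible. *)
Definition unit_lift (R : finComUnitRingType) (e x : R) (g : {unit R}) : Prop :=
  x * e = x /\ val g = x + (1 - e).

Section UnitLift.
Variables (R : finComUnitRingType) (e : R).
Hypothesis idem_e : e * e = e.

Lemma unit_lift1 : unit_lift e e 1%g.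
Proof. by split; rewrite // addrC subrK. Qed.

(** The cross terms vanish, because [1 - e] is idempotent and kills [x] and [y]. *)
Lemma unit_liftM x y g h :
  unit_lift e x g -> unit_lift e y h -> unit_lift e (x * y) (g * h)%g.
Proof.
move=> [xe gE] [ye hE]; split; first by rewrite -mulrA ye.
by rewrite /= gE hE; ring: xe ye idem_e.
Qed.

(** The exponent must be positive: [x ^+ 0] is 1, whereas the unit 1 corresponds to [e]. *)
Lemma unit_liftX x g k :
  unit_lift e x g -> unit_lift e (x ^+ k.+1) (g ^+ k.+1)%g.
Proof.
move=> xg; elim: k => [|k IHk]; first by rewrite expr1 expg1.
by rewrite exprS expgS; apply: unit_liftM.
Qed.

Lemma unit_lift_expg x g k :
  unit_lift e x g -> exists y, unit_lift e y (g ^+ k)%g.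
Proof.
move=> xg; case: k => [|k]; first by exists e; rewrite expg0; apply: unit_lift1.
by exists (x ^+ k.+1); apply: unit_liftX.
Qed.

Lemma unit_lift_inj x y g h :
  unit_lift e x g -> unit_lift e y h -> (x == y) = (g == h).
Proof. by move=> [_ gE] [_ hE]; rewrite -val_eqE gE hE (inj_eq (addIr _)). Qed.

Lemma unit_lift_ex x n :
  (0 < n)%N -> x ^+ n = e -> x ^+ n.+1 = x -> exists g, unit_lift e x g.
Proof.
case: n => // n _ xn xSn.
have xe : x * e = x by rewrite -xn -exprS.
pose u := x + (1 - e).
have uX k : u ^+ k.+1 = x ^+ k.+1 + (1 - e).
  elim: k => [|k IHk]; first by rewrite !expr1.
  by rewrite exprS IHk /u !exprS; ring: xe idem_e.
(* A positive power of [u] is [e + (1 - e) = 1]. *)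
have u_unit : u \is a GRing.unit.
  by rewrite -(unitrX_pos _ (ltn0Sn n)) uX xn addrC subrK unitr1.
by exists (FinRing.unit R u_unit).
Qed.

End UnitLift.

(** For [m <= 1] the type ['Z_m] is still the ring with two elements, hence the bound on [m]. *)
Lemma eq_intr_Zp (m : nat) (x y : int) : (1 < m)%N ->
  (x%:~R == y%:~R :> 'Z_m) = (x == y %[mod m])%Z.
Proof.
move=> m_gt1; rewrite eqz_mod_dvd -subr_eq0 -rmorphB /= dvdzE absz_nat.
have natE n : (n%:R == 0 :> 'Z_m) = (m %| n)%N.
  by rewrite -val_eqE /= val_Zp_nat.
case: (x - y) => n; first by rewrite -pmulrn natE.
by rewrite NegzE rmorphN /= oppr_eq0 -pmulrn natE.
Qed.

Lemma eq_residues (m : nat) (x y : int) :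
  x \in residues m -> y \in residues m ->
  (x == y %[mod m])%Z -> x = y.
Proof.
(* Shifting by 1 moves the representatives from 1, ..., [m] to the range where [modz] is the
   identity. *)
have small z : z \in residues m -> ((z - 1) %% m)%Z = z - 1.
  rewrite inE => /andP[z_ge1 z_le].
  by rewrite modz_small // subr_ge0 z_ge1 ltrBlDr ltzD1.
move=> /small xE /small yE; rewrite -(eqz_modDr (-1)) xE yE => /eqP.
exact: addIr.
Qed.

Lemma mem_idempotents_resmod (m : nat) (x : int) : (0 < m)%N ->
  (resmod m x \in idempotents m) = (x ^+ 2 == x %[mod m])%Z.
Proof.
by move=> m_gt0; rewrite inE resmod_residues //= -modzXm resmodE modzXm.
Qed.

Lemma res_orderP (m : nat) (a : int) : (0 < m)%N ->
  [/\ (0 < res_order m a)%N,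
      ((a ^+ res_order m a) ^+ 2 == a ^+ res_order m a %[mod m])%Z &
      forall k, (0 < k)%N -> ((a ^+ k) ^+ 2 == a ^+ k %[mod m])%Z ->
        (res_order m a <= k)%N].
Proof.
case: m => // m _; rewrite /res_order.
case: ex_minnP => n /andP[n_gt0]; rewrite mem_idempotents_resmod //.
move=> idn min_n.
by split=> // k k_gt0 idk; apply: min_n; rewrite k_gt0 mem_idempotents_resmod.
Qed.

Section RegularLift.
Variables (m : nat) (e : int).
Hypotheses (m_gt1 : (1 < m)%N) (idem_e : e \in idempotents m).

Local Notation lift x g :=
  (unit_lift (e%:~R : 'Z_m) (x%:~R) (g : {unit 'Z_m})).

Lemma idem_intr : e%:~R * e%:~R = e%:~R :> 'Z_m.
Proof.
have /andP[_] : e \in idempotents m := idem_e; rewrite -eq_intr_Zp // => /eqP.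
by rewrite rmorphXn /= expr2.
Qed.

(** The only idempotent of a group is its identity. *)
Lemma lift_power_idem x g k : lift x g ->
  ((x ^+ k.+1) ^+ 2 == x ^+ k.+1 %[mod m])%Z = (g ^+ k.+1 == 1)%g.
Proof.
move=> xg; have xkgk := unit_liftX idem_intr k xg.
rewrite -eq_intr_Zp // !rmorphXn /= expr2.
rewrite (unit_lift_inj (unit_liftM idem_intr xkgk xkgk) xkgk).
by rewrite -[X in _ == X]mulg1 (inj_eq (mulgI _)).
Qed.

Lemma res_order_lift x g : lift x g -> res_order m x = #[g]%g.
Proof.
move=> xg; have [] := res_orderP x (ltnW m_gt1).
case: (res_order m x) => // n _; rewrite (lift_power_idem n xg).
rewrite -order_dvdn => dv min_n.
apply/eqP; rewrite eqn_leq (dvdn_leq _ dv) // andbT.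
apply: min_n; rewrite ?order_gt0 //.
case E: #[g]%g (order_gt0 g) => [|k] // _.
by rewrite (lift_power_idem _ xg) -E expg_order.
Qed.

Lemma lift_regulars_at x g :
  x \in residues m -> lift x g -> x \in regulars_at m e.
Proof.
move=> mx xg; rewrite [_ \in _]inE [x \in regulars m]inE mx (res_order_lift xg).
rewrite -!eq_intr_Zp // !rmorphXn /= addn1.
case E: #[g]%g (order_gt0 g) => [|k] // _.
have xX j := unit_liftX idem_intr j xg.
rewrite (unit_lift_inj (xX _) xg).
rewrite (unit_lift_inj (xX _) (unit_lift1 idem_intr)).
by rewrite expgSr -E expg_order mul1g !eqxx.
Qed.

Lemma regulars_at_lift x : x \in regulars_at m e -> exists g, lift x g.
Proof.
rewrite [_ \in _]inE [x \in regulars m]inE -!eq_intr_Zp //.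
rewrite !rmorphXn /= addn1 => /andP[/andP[_ /eqP xS] /eqP xe].
have [n_gt0 _ _] := res_orderP x (ltnW m_gt1).
by have [g xg] := unit_lift_ex idem_intr n_gt0 xe xS; exists g.
Qed.

Lemma residue_lift (z : 'Z_m) g : unit_lift (e%:~R : 'Z_m) z g ->
  exists2 x, x \in residues m & lift x g.
Proof.
move=> zg; exists (resmod m (z : nat)%:Z); first exact/resmod_residues/ltnW.
suff -> : (resmod m (z : nat)%:Z)%:~R = z by [].
have /eqP -> : (resmod m (z : nat)%:Z)%:~R == (z : nat)%:Z%:~R :> 'Z_m.
  by rewrite eq_intr_Zp // resmodE.
by rewrite -pmulrn natr_Zp.
Qed.

Lemma mem_res_orbit_lift x y g h : x \in residues m -> lift x g -> lift y h ->
  (x \in res_orbit m y) = (g \in <[h]>%g).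
Proof.
move=> mx xg yh; have yX k := unit_liftX idem_intr k yh.
rewrite inE (res_order_lift yh); apply/mapP/idP.
  case=> -[|k]; rewrite mem_iota // => _ xE.
  suff /eqP -> : g == (h ^+ k.+1)%g by rewrite mem_cycle.
  rewrite -(unit_lift_inj xg (yX k)) -rmorphXn /=.
  by rewrite eq_intr_Zp // xE resmodE.
case/cyclePmin => k lt_k gE.
(* Orbit exponents run from 1 to the order, those of [cyclePmin] from 0 to the order minus 1; so 0
   is traded for [#[h]]. *)
pose n := if k is 0 then #[h]%g else k.
have n_gt0 : (0 < n)%N by rewrite /n; case: (k) => //; rewrite order_gt0.
have gnE : g = (h ^+ n)%g.
  by rewrite gE /n; case: (k) => //; rewrite expg_order expg0.
exists n.
  rewrite mem_iota n_gt0 add1n ltnS /n.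
  by case: (k) lt_k => [|k'] /= lt_k; rewrite ?leqnn ?(ltnW lt_k).
apply: (@eq_residues m) => //; first exact/resmod_residues/ltnW.
rewrite resmodE -eq_intr_Zp //.
case: n n_gt0 gnE => // n _ gnE.
by rewrite rmorphXn /= (unit_lift_inj xg (yX n)) gnE.
Qed.

End RegularLift.

Theorem theorem2p18 (m : nat) (e a b c : int) :
  (0 < m)%N ->
  e \in idempotents m ->
  a \in regulars_at m e -> b \in regulars_at m e -> c \in regulars_at m e ->
  a \in res_orbit m b -> a \in res_orbit m c ->
  exists d : int,
    [/\ d \in regulars_at m e,
        a \in res_orbit m d &
        res_order m d = lcmn (res_order m b) (res_order m c)].
Proof.
move=> m_gt0 idem_e ra rb rc ab ac.
(* For [m = 1] the lift to ['Z_m] fails, but 1 is the only residue and [b] itself serves as [d]. *)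
have [m_le1|m_gt1] := leqP m 1.
  have m1 : m = 1%N by apply/eqP; rewrite eqn_leq m_le1.
  have res1 x : x \in regulars_at m e -> x = 1.
    by rewrite !inE m1 => /andP[/andP[/le_anti]].
  by exists b; split=> //; rewrite (res1 _ rb) (res1 _ rc); apply/esym/lcmn_idPl.
have [ga aga] := regulars_at_lift m_gt1 idem_e ra.
have [gb bgb] := regulars_at_lift m_gt1 idem_e rb.
have [gc cgc] := regulars_at_lift m_gt1 idem_e rc.
have ma : a \in residues m.
  by move: ra; rewrite inE [a \in regulars m]inE => /andP[/andP[]].
have orbE := mem_res_orbit_lift m_gt1 idem_e ma aga.
rewrite (orbE _ _ bgb) in ab; rewrite (orbE _ _ cgc) in ac.
have cbc : commute gb gc by apply: val_inj; rewrite /= mulrC.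
have [i [j [awd od]]] := cycle_lcm_order cbc ab ac.
have idem := idem_intr m_gt1 idem_e.
(* The witness [d] represents the product of the elements lifting to [gb ^+ i] and [gc ^+ j]; an
   exponent 0 contributes the factor [e]. *)
have [x xg] := unit_lift_expg idem i bgb.
have [y yg] := unit_lift_expg idem j cgc.
have [d md dg] := residue_lift m_gt1 (unit_liftM idem xg yg).
exists d; split; first exact: lift_regulars_at dg.
  by rewrite (orbE _ _ dg).
by rewrite (res_order_lift m_gt1 idem_e dg) od (res_order_lift m_gt1 idem_e bgb)
  (res_order_lift m_gt1 idem_e cgc).
Qed.
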